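(* Let $T$ be a tree of order at least three and let $e$ be an edge of the complement $\overline{T}$ (i.e., $e$ joins two nonadjacent vertices of $T$). Let $T+e$ be the unicyclic graph obtained from $T$ by adding the edge $e$. Then $$\dim(T)-2 \le \dim(T+e) \le \dim(T)+1.$$
   Context: $\dim(G)$ denotes the metric dimension of a connected graph $G$: the minimum cardinality of a set $W\subseteq V(G)$ such that for every pair of distinct vertices $u,v$ there exists $w\in W$ with $d(u,w)\ne d(v,w)$, $d$ being shortest-path distance. *)

(* Defs.v *)
From mathcomp Require Import all_boot.

Set Implicit Arguments.
Unset Strict Implicit.
Unset Printing Implicit Defensive.

Section Graphs.

Variable T : finType.
Implicit Types (e : rel T) (W : {set T}).

Definition simple_graph e : Prop := symmetric e /\ irreflexive e.

Definition connected_graph e : Prop := forall x y : T, connect e x y.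

Definition acyclic_graph e : Prop :=
  forall c : seq T, 2 < size c -> ~ ucycle e c.

Definition is_tree e : Prop :=
  [/\ simple_graph e, connected_graph e & acyclic_graph e].

Definition compl_graph e : rel T := [rel x y | (x != y) && ~~ e x y].

Definition add_edge e (a b : T) : rel T :=
  [rel x y | [|| e x y, (x == a) && (y == b) | (x == b) && (y == a)]].

Definition has_walk e (x y : T) (k : nat) : bool :=
  [exists p : k.-tuple T, path e x p && (last x p == y)].

(* Least length of a walk from x to y. A shortest walk has fewer than #|T|
   edges, so the search is bounded by #|T|; the value is #|T| exactly when y
   is not reachable from x. *)
Definition gdist e (x y : T) : nat := find (has_walk e x y) (iota 0 #|T|).

Definition resolving e W : Prop :=
  forall u v : T, u != v -> exists2 w, w \in W & gdist e u w != gdist e v w.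

Definition resolvingb e W : bool :=
  [forall u, forall v, (u != v) ==>
    [exists w in W, gdist e u w != gdist e v w]].

Definition metric_dim e : nat :=
  #|[arg min_(W < [set: T] | resolvingb e W) #|W| ]|.

Lemma has_walkP e x y k :
  reflect (exists p, [/\ size p = k, path e x p & last x p = y])
          (has_walk e x y k).
Proof.
apply: (iffP existsP) => [[p /andP[pp /eqP lp]]|[p [sp pp lp]]].
  by exists p; rewrite size_tuple.
have sp' : size p == k by rewrite sp.
by exists (Tuple sp'); rewrite /= pp lp eqxx.
Qed.

Lemma gdist_walk e x y : connect e x y ->
  exists p, [/\ size p = gdist e x y, path e x p & last x p = y].
Proof.
case/connectP=> p0 pp ->; case/shortenP: pp => p pp up _.
have ltp : size p < #|T|.
  by have := max_card (mem (x :: p)); rewrite (card_uniqP up).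
have hw : has (has_walk e x (last x p)) (iota 0 #|T|).
  by apply/hasP; exists (size p); rewrite ?mem_iota //; apply/has_walkP; exists p.
apply/has_walkP; have := nth_find 0 hw.
by rewrite nth_iota ?add0n //; move: hw; rewrite has_find size_iota.
Qed.

Lemma gdist_min e x p : path e x p -> gdist e x (last x p) <= size p.
Proof.
move=> pp; rewrite leqNgt; apply/negP => lt.
have ltT : size p < #|T|.
  by apply: leq_trans lt _; rewrite -[leqRHS](size_iota 0) find_size.
have := before_find 0 lt; rewrite nth_iota // add0n => /has_walkP[].
by exists p.
Qed.

Lemma resolvingP e W : reflect (resolving e W) (resolvingb e W).
Proof.
apply: (iffP forallP) => [h u v uv|h u].
  by have /forallP/(_ v)/implyP/(_ uv)/exists_inP := h u.
by apply/forallP => v; apply/implyP => uv; apply/exists_inP; apply: h.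
Qed.

Lemma gdist0 e x y : (gdist e x y == 0) = (x == y).
Proof.
have T0 : 0 < #|T| by apply/card_gt0P; exists x.
rewrite /gdist; case: #|T| T0 => //= n _.
case: (has_walkP e x y 0) => [[p [/size0nil-> _ <-]]|nw]; first by rewrite !eqxx.
by apply/esym/negbTE/eqP => xy; apply: nw; exists [::].
Qed.

Lemma resolving_setT e : resolving e [set: T].
Proof.
move=> u v uv; exists u; first by rewrite inE.
have /eqP-> : gdist e u u == 0 by rewrite gdist0.
by rewrite eq_sym gdist0 eq_sym.
Qed.

Lemma metric_dim_witness e : exists2 W, resolving e W & #|W| = metric_dim e.
Proof.
rewrite /metric_dim; case: arg_minnP => [|W /resolvingP rW _]; last by exists W.
exact/resolvingP/resolving_setT.
Qed.

Lemma metric_dim_min e W : resolving e W -> metric_dim e <= #|W|.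
Proof.
move=> /resolvingP rW; rewrite /metric_dim; case: arg_minnP => [|V _]; last exact.
exact/resolvingP/resolving_setT.
Qed.

End Graphs.

(* Main.v *)
(* Let [m] be the distance in the tree from [a] to [b].  By the four-point
   condition a vertex is located, relative to the path from [a] to [b], by its
   branch (the index of the nearest path vertex) and its height (the distance
   to it), and distances between different branches are heights plus the
   distance along the path, respectively along the cycle of length [m + 1] once
   the edge is added; distances inside a branch do not change.
   Lower bound: if [W] resolves the unicyclic graph, then [W], [a] and [b]
   resolve the tree, since [a] and [b] determine branch and height.
   Upper bound: a resolving set [W] of the tree separates any two vertices of
   one branch in the unicyclic graph too.  If [W] meets two branches, one cycle
   vertex completes it to three branches spread around the cycle, which
   separate vertices of different branches.  Otherwise [W] lies in the branch
   of [a], say; then the rest of the tree is a path hanging off [a], and its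
   far end is a suitable additional landmark. *)
Require Import Defs.
From mathcomp Require Import all_boot.
From mathcomp Require Import zify.

Set Implicit Arguments.
Unset Strict Implicit.
Unset Printing Implicit Defensive.

(** * Shortest-path distance in a connected graph *)

Section Distance.

Variables (T : finType) (e : rel T).
Hypotheses (e_sym : symmetric e) (e_conn : connected_graph e).

Lemma gdistxx x : gdist e x x = 0.
Proof. by apply/eqP; rewrite gdist0. Qed.

Lemma gdist_triangle x y z : gdist e x z <= gdist e x y + gdist e y z.
Proof.
have [p [<- pp lp]] := gdist_walk (e_conn x y).
have [q [<- pq lq]] := gdist_walk (e_conn y z).
have := @gdist_min _ e x (p ++ q).
by rewrite cat_path last_cat lp lq pp pq size_cat => /(_ isT).
Qed.

Lemma gdist_edge x y : e x y -> gdist e x y <= 1.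
Proof. by move=> xy; apply: (@gdist_min _ e x [:: y]); rewrite /= xy. Qed.

Lemma gdist_step x y : x != y ->
  exists2 z, e x z & gdist e x y = (gdist e z y).+1.
Proof.
move=> xy; have [[|z p] [sp pp lp]] := gdist_walk (e_conn x y).
  by move: xy; rewrite -lp eqxx.
move: pp => /= /andP[xz pp]; exists z => //; apply/eqP; rewrite eqn_leq.
apply/andP; split.
  by have := gdist_triangle x z y; have := gdist_edge xz; lia.
by have := gdist_min pp; move: lp => /= ->; rewrite -sp /=; lia.
Qed.

Lemma gdist_sym x y : gdist e x y = gdist e y x.
Proof.
suff le u v : gdist e u v <= gdist e v u by apply/eqP; rewrite eqn_leq !le.
have [n] := ubnP (gdist e v u); elim: n v => // n IH v.
have [->|vu] := eqVneq v u; first by rewrite !gdistxx.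
have [z vz ->] := gdist_step vu => lt.
have := IH z lt; have := gdist_triangle u z v.
by rewrite e_sym in vz; have := gdist_edge vz; lia.
Qed.

Lemma gdist_between x y k : k <= gdist e x y ->
  exists2 z, gdist e x z = k & gdist e z y + k = gdist e x y.
Proof.
elim: k x => [|k IH] x lek; first by exists x; rewrite ?gdistxx ?addn0.
have xy : x != y by rewrite -(gdist0 e); lia.
have [z xz dxy] := gdist_step xy.
have [|t zt ty] := IH z; first by lia.
exists t; last by lia.
have := gdist_triangle x z t; have := gdist_triangle x t y.
have := gdist_edge xz; lia.
Qed.

End Distance.

(** * Trees: parents, the four-point condition, parity *)

Section Tree.

Variables (T : finType) (e : rel T).
Hypothesis e_tree : is_tree e.

Let e_sym : symmetric e. Proof. by case: e_tree => [[]]. Qed.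
Let e_irr : irreflexive e. Proof. by case: e_tree => [[]]. Qed.
Let e_conn : connected_graph e. Proof. by case: e_tree. Qed.
Let e_acyclic : acyclic_graph e. Proof. by case: e_tree. Qed.

Local Notation d := (gdist e).

Definition avoiding (u : T) : rel T :=
  [rel x y | [&& e x y, x != u & y != u]].

(** Past its start, a shortest walk to [y] stays closer to [y] than [u] is, so it never meets
    [u]. *)
Lemma connect_avoiding u x y : x != u -> d x y <= d u y ->
  connect (avoiding u) x y.
Proof.
have [n] := ubnP (d x y); elim: n x => // n IH x lt xu le.
have [->|xy] := eqVneq x y; first exact: connect0.
have [z xz dxy] := gdist_step e_conn xy.
have zu : z != u by apply/eqP => zu; rewrite zu in dxy; lia.
apply: connect_trans (IH z _ zu _); try lia.
by apply: connect1; rewrite /avoiding /= xz xu.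
Qed.

Lemma avoiding_path u x p : path (avoiding u) x p ->
  path e x p /\ u \notin p.
Proof.
elim: p x => //= z p IH x /andP[/and3P[xz _ zu] /IH[-> up]].
by rewrite xz inE negb_or eq_sym zu up.
Qed.

(** Otherwise a simple path from [y] to [p] missing [u] closes up through [u] to a cycle. *)
Lemma acyclic_neighbors u y p : e u y -> e u p ->
  connect (avoiding u) y p -> y = p.
Proof.
move=> uy up /connectP[q pq lq].
have yu : u != y by apply: contraTneq uy => ->; rewrite e_irr.
case/shortenP: pq lq => -[|z s] ps us _ lq //.
have [pe uns] := avoiding_path ps.
case: (@e_acyclic (u :: y :: z :: s)) => //.
rewrite /ucycle; apply/andP; split; last first.
  by move: us => /= ->; rewrite andbT inE (negbTE yu).
rewrite (cycle_path u) /= in pe *.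
move: pe => /andP[-> ->]; rewrite uy !andbT.
by move: lq => /= <-; rewrite e_sym.
Qed.

(* The parent of [u] when the tree is rooted at [r]: it lies on the way from [u]
   to every other vertex that is not deeper than [u]. *)
Lemma tree_parent r u v0 : u != v0 -> d v0 r <= d u r ->
  exists2 p, d u r = (d p r).+1 &
    forall v, u != v -> d v r <= d u r -> d u v = (d p v).+1.
Proof.
move=> uv0 le0.
have ur : u != r.
  by apply: contraNneq uv0 => ur; move: le0; rewrite ur gdistxx leqn0 gdist0 eq_sym.
have [p up dur] := gdist_step e_conn ur; exists p => // v uv le.
have [y uy duv] := gdist_step e_conn uv.
suff -> : p = y by [].
have nu z : e u z -> z != u by apply: contraTneq => ->; rewrite e_irr.
have asym : connect_sym (avoiding u).
  by apply: sym_connect_sym => x z; rewrite /avoiding /= e_sym; case: e => //=; rewrite andbC.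
(* The connection avoiding [u] runs from [p] to [r], on to [v], and back to [y]. *)
apply: (acyclic_neighbors up uy).
apply: connect_trans (connect_avoiding (nu _ up) (y := r) _) _; first lia.
rewrite asym; apply: connect_trans (connect_avoiding (nu _ uy) (y := v) _) _.
  by lia.
by apply: connect_avoiding; rewrite // eq_sym.
Qed.

Let S := gdist_sym e_sym e_conn.

(** Equivalently, the two largest of the three sums are equal. *)
Definition four_point u v x y :=
  [&& d u v + d x y <= maxn (d u x + d v y) (d u y + d v x),
      d u x + d v y <= maxn (d u v + d x y) (d u y + d v x) &
      d u y + d v x <= maxn (d u v + d x y) (d u x + d v y)].

(** Induction on total depth below a root [r]: replacing the deepest vertex by its parent lowers all
    three sums by one. If it equals another vertex, the triangle inequality suffices. *)
Lemma tree_four_point u v x y : four_point u v x y.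
Proof.
have [r _] : exists r, r = u by exists u.
have [n] := ubnP (d u r + d v r + d x r + d y r).
elim: n u v x y => // n IH.
suff top u v x y : d u r + d v r + d x r + d y r < n.+1 ->
    d v r <= d u r -> d x r <= d u r -> d y r <= d u r -> four_point u v x y.
  move=> u v x y lt.
  have : [|| [&& d v r <= d u r, d x r <= d u r & d y r <= d u r],
             [&& d u r <= d v r, d x r <= d v r & d y r <= d v r],
             [&& d v r <= d x r, d u r <= d x r & d y r <= d x r] |
             [&& d v r <= d y r, d x r <= d y r & d u r <= d y r]] by lia.
  case/or4P=> m;
    [have /and3P[] : four_point u v x y by apply: top; lia |
     have /and3P[] : four_point v u x y by apply: top; lia |
     have /and3P[] : four_point x v u y by apply: top; lia |
     have /and3P[] : four_point y v x u by apply: top; lia];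
    rewrite /four_point ?[d v u]S ?[d x u]S ?[d y u]S ?[d x v]S ?[d y v]S ?[d y x]S;
    by move=> *; apply/and3P; split; lia.
move=> lt vu xu yu; rewrite /four_point.
have [<-|nv] := eqVneq u v.
  by have := gdist_triangle e_conn x u y; rewrite gdistxx ![d x u]S; lia.
have [<-|nx] := eqVneq u x.
  by have := gdist_triangle e_conn v u y; rewrite gdistxx ![d v u]S; lia.
have [<-|ny] := eqVneq u y.
  by have := gdist_triangle e_conn v u x; rewrite gdistxx ![d v u]S ![d x u]S; lia.
have [p pr par] := tree_parent nv vu.
have /and3P[] : four_point p v x y by apply: IH; lia.
rewrite (par v nv vu) (par x nx xu) (par y ny yu) => *.
by apply/and3P; split; lia.
Qed.

(** The same descent lowers the perimeter by two. *)
Lemma tree_parity u v x : ~~ odd (d u v + d v x + d u x).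
Proof.
have [r _] : exists r, r = u by exists u.
have [n] := ubnP (d u r + d v r + d x r).
elim: n u v x => // n IH.
suff top u v x : d u r + d v r + d x r < n.+1 ->
    d v r <= d u r -> d x r <= d u r -> ~~ odd (d u v + d v x + d u x).
  move=> u v x lt.
  have [top1 top2 top3] := And3 (top u v x) (top v u x) (top x v u).
  by move: top1 top2 top3; rewrite [d v u]S [d x u]S [d x v]S; lia.
move=> lt vu xu.
have [<-|nv] := eqVneq u v; first by rewrite gdistxx; lia.
have [<-|nx] := eqVneq u x; first by rewrite gdistxx [d v u]S; lia.
have [p pr par] := tree_parent nv vu.
by have := IH p v x; rewrite (par v nv vu) (par x nx xu); lia.
Qed.

End Tree.

(** * Landmarks on a cycle *)

(* The distance between positions [i] and [j] on a cycle of length [m + 1]. *)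
Definition cyc (m i j : nat) := minn ((i - j) + (j - i)) (m.+1 - ((i - j) + (j - i))).

Lemma cycC m i j : cyc m i j = cyc m j i.
Proof. by rewrite /cyc addnC. Qed.

Lemma cyc_triangle m i j k : i <= m -> j <= m -> k <= m ->
  cyc m i k <= cyc m i j + cyc m j k.
Proof. by rewrite /cyc; lia. Qed.

Lemma cyc_gt0 m i j : i <= m -> j <= m -> i != j -> 0 < cyc m i j.
Proof. by rewrite /cyc; lia. Qed.

(** The geodesics between the three positions cover the cycle. *)
Definition cyc_spread m r1 r2 r3 := forall p, p <= m ->
  [\/ cyc m p r1 + cyc m p r2 = cyc m r1 r2,
      cyc m p r2 + cyc m p r3 = cyc m r2 r3 |
      cyc m p r1 + cyc m p r3 = cyc m r1 r3].

Lemma cyc_spread_lt m r1 r2 r3 : r1 < r2 -> r2 < r3 -> r3 <= m ->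
  (r2 - r1).*2 <= m.+1 -> (r3 - r2).*2 <= m.+1 -> m.+1 <= (r3 - r1).*2 ->
  cyc_spread m r1 r2 r3.
Proof.
move=> lt12 lt23 le3 A B C p lep; rewrite /cyc.
have [p1|p1] := leqP p r1; first by constructor 3; lia.
have [p2|p2] := leqP p r2; first by constructor 1; lia.
have [p3|p3] := leqP p r3; first by constructor 2; lia.
by constructor 3; lia.
Qed.

Lemma cyc_spread_exists m r1 r2 : 1 < m -> r1 < r2 -> r2 <= m ->
  exists k, [/\ k <= m, k != r1, k != r2 & cyc_spread m r1 r2 k].
Proof.
move=> m1 lt le.
(* [k] lies [m.+1./2.+1] steps, modulo [m.+1], past the start of the shorter arc between [r1] and
   [r2]; then no arc exceeds half of the cycle. *)
have [s|s] := leqP (r2 - r1) m.+1./2.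
  have [t|t] := leqP (r1 + m.+1./2.+1) m.
    exists (r1 + m.+1./2.+1); split; [lia..|].
    by apply: cyc_spread_lt; lia.
  exists (r1 + m.+1./2.+1 - m.+1); split; [lia..|] => p lep.
  have := @cyc_spread_lt m (r1 + m.+1./2.+1 - m.+1) r1 r2.
  move=> /(_ _ _ _ _ _ _ p lep)[]; try lia.
  - by rewrite (cycC m (_ - _)) => ?; constructor 3; lia.
  - by constructor 1.
  - by rewrite (cycC m (_ - _)) => ?; constructor 2; lia.
exists (r2 + m.+1./2.+1 - m.+1); split; [lia..|] => p lep.
have := @cyc_spread_lt m r1 (r2 + m.+1./2.+1 - m.+1) r2.
move=> /(_ _ _ _ _ _ _ p lep)[]; try lia.
- by constructor 3.
- by rewrite (cycC m (_ - _)) => ?; constructor 2; lia.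
- by constructor 1.
Qed.

(** Such positions are mirror images in [r], so [i + j] is [r.*2] modulo [m.+1]. *)
Lemma cyc_eq_mid m i j r : i <= m -> j <= m -> r <= m -> i != j ->
  cyc m i r = cyc m j r ->
  [\/ i + j = r.*2, i + j = r.*2 + m.+1 | i + j + m.+1 = r.*2].
Proof.
move=> lei lej ler ij; rewrite /cyc => E.
have [|n1] := eqVneq (i + j) r.*2; first by constructor 1.
have [|n2] := eqVneq (i + j) (r.*2 + m.+1); first by constructor 2.
by constructor 3; lia.
Qed.

(** Add the equations of the two landmarks whose geodesic contains [j] and use the triangle
    inequality at [i]. *)
Lemma cyc_spread_shift m r1 r2 r3 i j h h' :
  r1 <= m -> r2 <= m -> r3 <= m -> i <= m -> j <= m ->
  cyc_spread m r1 r2 r3 ->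
  h + cyc m i r1 = h' + cyc m j r1 ->
  h + cyc m i r2 = h' + cyc m j r2 ->
  h + cyc m i r3 = h' + cyc m j r3 -> h <= h'.
Proof.
move=> le1 le2 le3 lei lej sp E1 E2 E3.
by have := cyc_triangle le1 lei le2; have := cyc_triangle le2 lei le3;
   have := cyc_triangle le1 lei le3; rewrite ![cyc m _ i]cycC;
   case: (sp j lej); lia.
Qed.

Lemma cyc_spread_resolve m r1 r2 r3 i j h h' :
  r1 <= m -> r2 <= m -> r3 <= m -> i <= m -> j <= m ->
  r1 != r2 -> r3 != r1 -> r3 != r2 -> cyc_spread m r1 r2 r3 ->
  h + cyc m i r1 = h' + cyc m j r1 ->
  h + cyc m i r2 = h' + cyc m j r2 ->
  h + cyc m i r3 = h' + cyc m j r3 -> i = j.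
Proof.
move=> le1 le2 le3 lei lej n12 n31 n32 sp E1 E2 E3.
have hh : h = h'.
  have := cyc_spread_shift le1 le2 le3 lei lej sp E1 E2 E3.
  have := cyc_spread_shift le1 le2 le3 lej lei sp
           (esym E1) (esym E2) (esym E3).
  lia.
move: E1 E2 E3; rewrite hh => /addnI E1 /addnI E2 /addnI E3.
apply/eqP/negPn/negP => ij.
(* At most two positions have a double congruent to [i + j] modulo [m.+1]. *)
by case: (cyc_eq_mid lei lej le1 ij E1);
   case: (cyc_eq_mid lei lej le2 ij E2);
   case: (cyc_eq_mid lei lej le3 ij E3); lia.
Qed.

(** * Distances after adding an edge *)

Section AddEdge.

Variables (T : finType) (e : rel T) (a b : T).
Hypotheses (e_sym : symmetric e) (e_conn : connected_graph e).

Local Notation d := (gdist e).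
Local Notation f := (add_edge e a b).
Local Notation d' := (gdist f).

Lemma sub_add_edge : subrel e f.
Proof. by move=> x y xy; rewrite /add_edge /= xy. Qed.

Lemma add_edge_conn : connected_graph f.
Proof.
move=> x y; apply: connect_sub (e_conn x y) => u v uv.
exact/connect1/sub_add_edge.
Qed.

(* A shortest walk uses the new edge at most once. *)
Lemma gdist_add_edge x y :
  d' x y = minn (d x y) (minn (d x a + 1 + d b y) (d x b + 1 + d a y)).
Proof.
have S := gdist_sym e_sym e_conn.
apply/eqP; rewrite eqn_leq; apply/andP; split.
  have le u v : d' u v <= d u v.
    have [p [<- pp <-]] := gdist_walk (e_conn u v).
    exact/gdist_min/(sub_path sub_add_edge).
  have ab : d' a b <= 1 by apply: gdist_edge; rewrite /add_edge /= !eqxx orbT.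
  have ba : d' b a <= 1 by apply: gdist_edge; rewrite /add_edge /= !eqxx !orbT.
  have := gdist_triangle add_edge_conn x a y.
  have := gdist_triangle add_edge_conn a b y.
  have := gdist_triangle add_edge_conn x b y.
  have := gdist_triangle add_edge_conn b a y.
  have := le x y; have := le x a; have := le x b.
  by have := le a y; have := le b y; lia.
(* Conversely, induct along a shortest walk, whose first edge is old or is the new one in either
   direction. *)
have [n] := ubnP (d' x y); elim: n x => // n IH x.
have [->|xy] := eqVneq x y; first by rewrite !gdistxx min0n.
have [z xz ->] := gdist_step add_edge_conn xy => lt.
have := IH z lt; case/or3P: xz => [xz|/andP[/eqP-> /eqP->]|/andP[/eqP-> /eqP->]].
- have := gdist_edge xz; have := gdist_triangle e_conn x z y.
  have := gdist_triangle e_conn x z a; have := gdist_triangle e_conn x z b; lia.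
- rewrite !gdistxx; lia.
- rewrite !gdistxx; lia.
Qed.

End AddEdge.

Lemma gdist_add_edgeC (T : finType) (e : rel T) (a b x y : T) :
  symmetric e -> connected_graph e ->
  gdist (add_edge e a b) x y = gdist (add_edge e b a) x y.
Proof. by move=> es ec; rewrite !gdist_add_edge // [X in minn _ X]minnC. Qed.

(** * Branch and height coordinates; the lower bound *)

Section Unicyclic.

Variables (T : finType) (e : rel T) (a b : T).
Hypothesis e_tree : is_tree e.

Let e_sym : symmetric e. Proof. by case: e_tree => [[]]. Qed.
Let e_conn : connected_graph e. Proof. by case: e_tree. Qed.
Let S := gdist_sym e_sym e_conn.

Local Notation d := (gdist e).
Local Notation d' := (gdist (add_edge e a b)).
Local Notation m := (gdist e a b).

(* The path from [a] to [b] is the cycle of the unicyclic graph; [pos u] is the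
   index on it of the vertex nearest to [u], and [ht u] the distance to it. *)
Definition pos u := (d u a + m - d u b)./2.
Definition ht u := (d u a + d u b - m)./2.

(** Parity makes the halves exact, and triangle inequalities keep the subtractions from
    truncating. *)
Lemma pos_htP u : [/\ pos u <= m, d u a = ht u + pos u & d u b + pos u = ht u + m].
Proof.
have p := tree_parity e_tree u a b.
have := gdist_triangle e_conn u a b; have := gdist_triangle e_conn u b a.
have := gdist_triangle e_conn a u b; rewrite [d a u]S [d b a]S.
by rewrite /pos /ht; split; lia.
Qed.

(** The two sums pairing [u] and [v] with the ends differ, so [d u v + m] equals the larger one. *)
Lemma gdist_pos_neq u v : pos u != pos v ->
  d u v = ht u + ht v + ((pos u - pos v) + (pos v - pos u)).
Proof.
have /and3P[] := tree_four_point e_tree u v a b.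
have [pu ua ub] := pos_htP u; have [pv va vb] := pos_htP v.
by rewrite ?[d a u]S; lia.
Qed.

Lemma gdist_pos_eq u v : pos u = pos v -> d u v <= ht u + ht v.
Proof.
have /and3P[] := tree_four_point e_tree u v a b.
have [pu ua ub] := pos_htP u; have [pv va vb] := pos_htP v.
by lia.
Qed.

Lemma cycle_gdist_pos_neq u v : pos u != pos v ->
  d' u v = ht u + ht v + cyc m (pos u) (pos v).
Proof.
move=> uv; rewrite gdist_add_edge // (gdist_pos_neq uv) [d b v]S [d a v]S /cyc.
have [pu ua ub] := pos_htP u; have [pv va vb] := pos_htP v.
by lia.
Qed.

(** A detour over the new edge costs [ht u + ht v + m + 1], which is too long. *)
Lemma cycle_gdist_pos_eq u v : pos u = pos v -> d' u v = d u v.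
Proof.
move=> uv; rewrite gdist_add_edge // [d b v]S [d a v]S.
have := gdist_pos_eq uv.
have [pu ua ub] := pos_htP u; have [pv va vb] := pos_htP v.
by lia.
Qed.

Lemma cycle_vertex k : k <= m -> exists c, [/\ pos c = k, ht c = 0 & d c a = k].
Proof.
move=> km; have [c ac cb] := gdist_between e_conn km; exists c.
by rewrite /pos /ht [d c a]S; split; lia.
Qed.

Lemma resolving_add_ends W : resolving (add_edge e a b) W ->
  resolving e (a |: (b |: W)).
Proof.
move=> rW u v uv.
have [eqa|] := eqVneq (d u a) (d v a); last by exists a; rewrite // !inE eqxx.
have [eqb|] := eqVneq (d u b) (d v b); last by exists b; rewrite // !inE eqxx orbT.
have [pu ua ub] := pos_htP u; have [pv va vb] := pos_htP v.
have epos : pos u = pos v by lia.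
have eht : ht u = ht v by lia.
(* A landmark in another branch sees only branch and height, so [w] lies in the branch of [u] and
   [v]. *)
have [w wW] := rW _ _ uv.
have [uw|uw] := eqVneq (pos u) (pos w).
  rewrite !cycle_gdist_pos_eq -?epos // => neq.
  by exists w => //; rewrite !inE wW !orbT.
by rewrite !cycle_gdist_pos_neq -?epos // eht eqxx.
Qed.

Lemma resolving_same_pos W u v : resolving e W -> u != v -> pos u = pos v ->
  exists2 w, w \in W & d' u w != d' v w.
Proof.
move=> rW uv epos; have [w wW neq] := rW _ _ uv; exists w => //.
have [uw|uw] := eqVneq (pos u) (pos w).
  by rewrite !cycle_gdist_pos_eq -?epos.
move: neq; rewrite !gdist_pos_neq -?epos // !cycle_gdist_pos_neq -?epos //.
by lia.
Qed.

Lemma cycle_gdist_le u w : pos u = pos w -> d' u w <= ht u + ht w.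
Proof. by move=> uw; rewrite cycle_gdist_pos_eq //; apply: gdist_pos_eq. Qed.

Lemma spread_resolve (w1 w2 w3 u v : T) :
  pos w1 != pos w2 -> pos w3 != pos w1 -> pos w3 != pos w2 ->
  cyc_spread m (pos w1) (pos w2) (pos w3) -> pos u != pos v ->
  [|| d' u w1 != d' v w1, d' u w2 != d' v w2 | d' u w3 != d' v w3].
Proof.
move=> n12 n31 n32 sp uv; apply/negP => /negP.
rewrite !negb_or !negbK => /and3P[/eqP E1 /eqP E2 /eqP E3].
have [[pu _ _] [pv _ _]] := (pos_htP u, pos_htP v).
have [[p1 _ _] [p2 _ _] [p3 _ _]] := And3 (pos_htP w1) (pos_htP w2) (pos_htP w3).
have cuv := cyc_gt0 pu pv uv.
have key w : d' u w = d' v w -> [\/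
    [/\ pos u = pos w & ht v + cyc m (pos u) (pos v) <= ht u],
    [/\ pos v = pos w & ht u + cyc m (pos u) (pos v) <= ht v] |
    [/\ pos w != pos u, pos w != pos v &
     ht u + cyc m (pos u) (pos w) = ht v + cyc m (pos v) (pos w)]].
  have [uw|uw] := eqVneq (pos u) (pos w).
    have := cycle_gdist_le uw; rewrite (cycle_gdist_pos_neq (u := v)) -?uw 1?eq_sym //.
    by rewrite [cyc _ (pos v) _]cycC => ? ?; constructor 1; split=> //; lia.
  have [vw|vw] := eqVneq (pos v) (pos w).
    have := cycle_gdist_le vw; rewrite (cycle_gdist_pos_neq (u := u)) -?vw //.
    by move=> ? ?; constructor 2; split=> //; lia.
  rewrite !cycle_gdist_pos_neq // => ?; constructor 3.
  by split; rewrite 1?eq_sym //; lia.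
(* The distance formula persists when [w] shares a branch with [u] or [v]: [key] gives one
   inequality, and [w'], in another branch, the reverse one. *)
have eq_of w w' : pos w != pos w' -> pos w <= m -> pos w' <= m ->
    d' u w = d' v w -> d' u w' = d' v w' ->
    ht u + cyc m (pos u) (pos w) = ht v + cyc m (pos v) (pos w).
  move=> ww' pw pw' /key K /key K'.
  have := cyc_triangle pu pv pw'; have := cyc_triangle pv pu pw'.
  have c0 i : cyc m i i = 0 by rewrite /cyc; lia.
  rewrite [cyc m (pos v) (pos u)]cycC.
  case: K => [[k1 k2]|[k1 k2]|[//]].
    rewrite -!k1 c0 (cycC m (pos v) (pos u)).
    by case: K' => [[]|[]|[]]; lia.
  rewrite -!k1 c0.
  by case: K' => [[]|[]|[]]; lia.
move/eqP: uv; apply.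
apply: (cyc_spread_resolve p1 p2 p3 pu pv n12 n31 n32 sp).
- exact: (eq_of w1 w2).
- by apply: (eq_of w2 w1) => //; rewrite eq_sym.
- exact: (eq_of w3 w1).
Qed.

(** * The additional landmark for the upper bound *)

Hypothesis ab_compl : compl_graph e a b.

Lemma compl_gdist : 1 < m.
Proof.
move: ab_compl; rewrite /compl_graph /= => /andP[ab nab].
have [z az dz] := gdist_step e_conn ab; rewrite dz ltnS lt0n gdist0.
by apply: contraNneq nab => <-.
Qed.

Lemma two_branches_resolving W w1 w2 : resolving e W -> w1 \in W -> w2 \in W ->
  pos w1 < pos w2 -> exists x, resolving (add_edge e a b) (x |: W).
Proof.
move=> rW w1W w2W lt; have [p2 _ _] := pos_htP w2.
have [k [km k1 k2 sp]] := cyc_spread_exists compl_gdist lt p2.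
have [x [px _ _]] := cycle_vertex km; exists x => u v uv.
have [epos|npos] := eqVneq (pos u) (pos v).
  have [w wW neq] := resolving_same_pos rW uv epos.
  by exists w; rewrite // inE wW orbT.
have := @spread_resolve w1 w2 x u v; rewrite px => /(_ _ k1 k2 sp npos).
case/(_ _)/or3P; first by lia.
- by exists w1; rewrite // inE w1W orbT.
- by exists w2; rewrite // inE w2W orbT.
- by exists x; rewrite // !inE eqxx.
Qed.

Lemma end_branch_resolving W : resolving e W -> W != set0 ->
  (forall w, w \in W -> pos w = 0) ->
  exists x, resolving (add_edge e a b) (x |: W).
Proof.
move=> rW /set0Pn[w0 w0W] pos0; have m1 := compl_gdist.
have da u w : w \in W -> pos u != 0 -> d u w = ht w + d u a.
  move=> wW pu; have [_ ua _] := pos_htP u.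
  by rewrite gdist_pos_neq (pos0 w wW) //; lia.
(* Off the branch of [a], landmarks see only the distance to [a], which therefore determines the
   vertex. *)
have inj u v : pos u != 0 -> pos v != 0 -> d u a = d v a -> u = v.
  move=> pu pv uv; apply/eqP/negPn/negP => /rW[w wW].
  by rewrite (da u w wW pu) (da v w wW pv) uv eqxx.
have [b_pos b_ht] : pos b = m /\ ht b = 0.
  by rewrite /pos /ht gdistxx [d b a]S; split; lia.
have back u k : pos u != 0 -> 0 < k -> k <= d u a ->
    exists2 z, pos z != 0 /\ d z a = k & d u z + k = d u a.
  move=> pu k0 ku; have [_ ua _] := pos_htP u.
  have [z uz za] := gdist_between e_conn (leq_subr k (d u a)).
  have [_ za' _] := pos_htP z.
  exists z; last by lia.
  split; last by lia.
  apply: contraTneq k0 => z0.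
  have := gdist_pos_neq (u := u) (v := z); rewrite z0 => /(_ pu); lia.
(* A vertex within distance [m] of [a] is the cycle vertex at that distance; one farther away
   reaches [a] through [b]. *)
have inner u : pos u != 0 -> pos u != m -> ht u = 0.
  move=> pu pm; have [lem ua ub] := pos_htP u.
  have [le|lt] := leqP (d u a) m.
    have [c [pc hc ca]] := cycle_vertex le.
    have cu : c = u by apply: inj; lia.
    by rewrite cu in hc.
  have [||z [pz za] uz] := @back u m pu; [lia..|].
  have zb : z = b by apply: inj => //; [lia | rewrite za [d b a]S].
  by rewrite zb in uz; lia.
(* [x] is the far end of the path hanging off [a]. *)
have [x /eqP px xmax] :
    exists2 x, pos x == m & forall u, pos u = m -> ht u <= ht x.
  exists [arg max_(x > b | pos x == m) ht x].
    by case: arg_maxnP; rewrite ?b_pos.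
  by case: arg_maxnP => [|x _ xm u /eqP]; rewrite ?b_pos //; apply: xm.
have tail u : pos u = m -> d u x + ht u = ht x.
  move=> pu; have := xmax u pu.
  have [_ ua _] := pos_htP u; have [_ xa _] := pos_htP x => le.
  have [|||z [pz za] xz] := @back x (d u a); [lia..|].
  have zu : z = u by apply: inj; lia.
  by rewrite zu in xz; rewrite S; lia.
exists x => u v uv.
have [epos|npos] := eqVneq (pos u) (pos v).
  have [w wW neq] := resolving_same_pos rW uv epos.
  by exists w; rewrite // inE wW orbT.
suff: ~ (d' u x = d' v x /\ forall w, w \in W -> d' u w = d' v w).
  move=> H; apply/exists_inP; apply: contraT => /existsPn none.
  case: H; split=> [|w wW]; apply/eqP.
    by have := none x; rewrite !inE eqxx /= negbK.
  by have := none w; rewrite inE wW orbT /= negbK.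
wlog lt : u v {uv} npos / pos u < pos v.
  move=> H; have [/H|lt|eq] := ltngtP (pos u) (pos v); first exact.
    move=> [E Ew]; apply: (H v u) => //; first by rewrite eq_sym.
    by split=> // w wW; rewrite Ew.
  by rewrite eq eqxx in npos.
move=> [Ex Ew]; have [[lu ua ub] [lv va vb]] := (pos_htP u, pos_htP v).
have pv0 : pos v != 0 by lia.
have [pvm|pvm] := eqVneq (pos v) m.
  have pux : pos u != pos x by rewrite px -pvm.
  have := tail v pvm; rewrite -cycle_gdist_pos_eq ?pvm ?px // -Ex.
  rewrite (cycle_gdist_pos_neq pux).
  by have [px' _ _] := pos_htP x; have := cyc_gt0 lu px' pux; lia.
have hv := inner v pv0 pvm.
move: Ex; rewrite !cycle_gdist_pos_neq ?px //; last by lia.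
have [pu0|pu0] := eqVneq (pos u) 0.
  rewrite pu0 hv => Ex.
  (* [W] bounds [ht u] below by the cycle distance from [v] to [a], and [x] bounds it above, since
     positions [0] and [m] are adjacent. *)
  have hu : ht u = cyc m (pos v) 0 /\ forall w, w \in W -> d u w = ht u + ht w.
    have Eu w : w \in W -> d u w = ht w + cyc m (pos v) 0.
      move=> wW; have pw := pos0 w wW.
      rewrite -cycle_gdist_pos_eq ?pw // Ew // cycle_gdist_pos_neq ?pw // hv.
      by rewrite add0n.
    have ub0 w : w \in W -> d u w <= ht u + ht w.
      by move=> wW; apply: gdist_pos_eq; rewrite (pos0 w wW).
    have h0 : ht u = cyc m (pos v) 0.
      have := Eu _ w0W; have := ub0 _ w0W; move: Ex; rewrite /cyc; lia.
    by split=> // w wW; rewrite Eu // h0; lia.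
  case: hu => hu du.
  have hum : ht u <= m by rewrite hu /cyc; lia.
  have hu0 : 0 < ht u by rewrite hu; apply: cyc_gt0.
  (* In the tree, no landmark separates [u] from the cycle vertex at distance [ht u] from [a]. *)
  have [c [pc hc ca]] := cycle_vertex hum.
  have uc : u != c by apply: contraTneq hu0 => uc; rewrite uc hc.
  have [w wW] := rW _ _ uc.
  by rewrite (du w wW) (da c w wW) ?ca ?pc -?lt0n // addnC eqxx.
(* Both are now cycle vertices, separated by the adjacent positions [0] and [m] because the cycle
   has at least three vertices. *)
have hu : ht u = 0 by apply: inner => //; lia.
have := Ew _ w0W; rewrite !cycle_gdist_pos_neq (pos0 w0 w0W) // hu hv.
by rewrite /cyc; lia.
Qed.

End Unicyclic.

(** * Both bounds assembled *)

Theorem theorem3p1 (T : finType) (e : rel T) (a b : T) :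
  is_tree e -> 3 <= #|T| -> compl_graph e a b ->
  metric_dim e - 2 <= metric_dim (add_edge e a b) <= metric_dim e + 1.
Proof.
move=> e_tree T3 ab; have [[e_sym _] e_conn _] := e_tree.
apply/andP; split.
  have [W rW <-] := metric_dim_witness (add_edge e a b).
  have := metric_dim_min (resolving_add_ends e_tree rW).
  by rewrite !cardsU1; lia.
have [W rW <-] := metric_dim_witness e.
suff [x rx] : exists x, resolving (add_edge e a b) (x |: W).
  by have := metric_dim_min rx; rewrite cardsU1; lia.
have m1 := compl_gdist e_tree ab.
have W0 : W != set0.
  apply: contraTneq m1 => W0; have [->|/rW[w]] := eqVneq a b.
    by rewrite gdistxx.
  by rewrite W0 inE.
have [/exists_inP[w1 w1W /exists_inP[w2 w2W lt]]|one] :=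
  boolP [exists w1 in W, exists w2 in W, pos e a b w1 < pos e a b w2].
  exact: two_branches_resolving w1W w2W lt.
have same w w' : w \in W -> w' \in W -> pos e a b w <= pos e a b w'.
  move=> wW w'W; rewrite leqNgt; apply: contra one => lt.
  by apply/exists_inP; exists w' => //; apply/exists_inP; exists w.
have [w0 w0W] := set0Pn _ W0.
have posW w : w \in W -> pos e a b w = pos e a b w0.
  by move=> wW; apply/eqP; rewrite eqn_leq !same.
have [r0|r0] := eqVneq (pos e a b w0) 0.
  by apply: end_branch_resolving => // w /posW->.
have [rm|rm] := eqVneq (pos e a b w0) (gdist e a b).
  (* Exchanging [a] and [b] turns position [m] into [0]. *)
  have ba : compl_graph e b a.
    by move: ab; rewrite /compl_graph /= eq_sym e_sym.
  have [w wW|x rx] := end_branch_resolving e_tree ba rW W0.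
    have [_ wa wb] := pos_htP a b e_tree w; have pw := posW _ wW.
    by rewrite {1}/pos [gdist e b a]gdist_sym //; lia.
  exists x => u v uv; have [w wx neq] := rx u v uv.
  by exists w; rewrite // !(gdist_add_edgeC a b).
have [rle _ _] := pos_htP a b e_tree w0.
(* [W] cannot lie in an inner branch: the cycle vertices on its two sides are equally far from all
   of it. *)
have [|c [pc hc _]] := @cycle_vertex _ e a b e_tree (pos e a b w0).-1.
  by lia.
have [|c' [pc' hc' _]] := @cycle_vertex _ e a b e_tree (pos e a b w0).+1.
  by lia.
have cc' : c != c' by apply/eqP => cc'; rewrite cc' in pc; lia.
have [w wW] := rW _ _ cc'; have := posW _ wW => pw.
rewrite !(gdist_pos_neq (a := a) (b := b)) // ?pc ?pc' ?hc ?hc' ?pw; lia.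
Qed.
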